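(* Let $n\ge2$, let $X\subseteq\mathbb{R}^n$ be open, let $U$ be finite, and let $G\colon X\times U\to X$ be such that for every $w\in U$ the map $G(\cdot,w)$ is a $C^1$-diffeomorphism onto an open subset of $X$ and is of class $C^{1,1}$. Let $\psi$ be the general solution of $x_{k+1}=G(x_k,u_k)$. Let further be given some $N\in\mathbb{N}$, a compact subset $K\subseteq X$, an open neighborhood $V\subseteq X$ of $K$, as well as a full-dimensional, convex polyhedron $Y\subseteq\mathbb{R}^n$ together with a strongly convex set $\widehat Y\subseteq\mathbb{R}^n$ for which $Y\subseteq\widehat Y\neq\mathbb{R}^n$. Then there are a finite subset $Z\subseteq\mathbb{R}^n$, some $\lambda>0$, and a superset $C$ of the set $$C'=\{z+\lambda Y: z\in Z\}$$ such that the following hold: (i) $C$ is a finite covering of $\mathbb{R}^n$ whose elements are nonempty convex polyhedra, and for each cell $\Delta\in C'$ there is a superset $\widehat\Delta\supseteq\Delta$ such that $\widehat\Delta\subseteq X$ and the attainable sets $\psi(k,\widehat\Delta,u)$ are convex for all $k\in[1;N]$ and all $u\colon[0;k[\,\to U$; (ii) $K\subseteq Z+\lambda Y\subseteq Z+\lambda\widehat Y\subseteq V$. Moreover, (these can be chosen such that) $\Delta\cap\operatorname{int}\Delta'=\emptyset$ for all $\Delta\in C\setminus C'$ and all $\Delta'\in C'$, and one may additionally require $\Delta\cap K=\emptyset$ for all $\Delta\in C\setminus C'$.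
   Context: $\mathbb{Z}_+=\{0,1,2,\dots\}$; $[a;b]$, $[a;b[$ denote the sets of integers $j$ with $a\le j\le b$, resp. $a\le j<b$. $C^{1,1}$ is the class of $C^1$ maps with locally Lipschitz continuous derivative. A convex polyhedron is a finite intersection of closed half-spaces; full-dimensional means having nonempty interior. Operations on sets are pointwise: $z+\lambda Y=\{z+\lambda y:y\in Y\}$, $Z+\lambda Y=\{z+\lambda y:z\in Z,y\in Y\}$. General solution: $\psi(0,x_0,u)=x_0$, $\psi(k+1,x_0,u)=G(\psi(k,x_0,u),u_k)$ (only $u_0,\dots,u_{k-1}$ matter for $\psi(k,x_0,u)$), and $\psi(k,\Omega,u)=\{\psi(k,x,u):x\in\Omega\}$. A set is $r$-convex ($r>0$) if it is the intersection of a family of closed Euclidean balls of radius $r$, and strongly convex if it is $r$-convex for some $r>0$. *)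

(* Defs.v *)
From HB Require Import structures.
From mathcomp Require Import all_boot all_order all_algebra.
From mathcomp Require Import all_classical all_reals all_analysis.

Set Implicit Arguments.
Unset Strict Implicit.
Unset Printing Implicit Defensive.

Import Order.TTheory GRing.Theory Num.Theory.
Import numFieldNormedType.Exports.

Local Open Scope classical_set_scope.
Local Open Scope ring_scope.

(* The norm of 'rV[R]_n in the library is the sup norm; balls must be
   Euclidean here, while all topological notions agree. *)
Definition dotv (R : realType) (n : nat) (x y : 'rV[R]_n) : R :=
  \sum_(i < n) x 0 i * y 0 i.

Definition eball (R : realType) (n : nat) (c : 'rV[R]_n) (r : R) :
    set 'rV[R]_n :=
  [set x | Num.sqrt (dotv (x - c) (x - c)) <= r].

(* The family of balls may be empty, so the whole space is r-convex. *)
Definition r_convex (R : realType) (n : nat) (r : R) (A : set 'rV[R]_n) :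
    Prop :=
  exists D : set 'rV[R]_n, A = \bigcap_(c in D) eball c r.

Definition strongly_convex (R : realType) (n : nat) (A : set 'rV[R]_n) :
    Prop :=
  exists2 r : R, 0 < r & r_convex r A.

Definition closed_halfspace (R : realType) (n : nat) (H : set 'rV[R]_n) :
    Prop :=
  exists (a : 'rV[R]_n) (b : R), a != 0 /\ H = [set x | dotv a x <= b].

Definition convex_polyhedron (R : realType) (n : nat) (P : set 'rV[R]_n) :
    Prop :=
  exists F : set (set 'rV[R]_n),
    [/\ finite_set F,
        forall H, F H -> closed_halfspace H
      & P = \bigcap_(H in F) H].

(* In the next three definitions A is meant to be open, so that the values of
   f outside A do not affect its derivative at the points of A. *)
Definition C1_on (R : realType) (n : nat) (A : set 'rV[R]_n)
    (f : 'rV[R]_n -> 'rV[R]_n) : Prop :=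
  (forall x, A x -> differentiable f x) /\
  {within A, continuous (jacobian f)}.

Definition C11_on (R : realType) (n : nat) (A : set 'rV[R]_n)
    (f : 'rV[R]_n -> 'rV[R]_n) : Prop :=
  C1_on A f /\ [locally [lipschitz (jacobian f x) | x in A]].

Definition C1_diffeo_on (R : realType) (n : nat) (A : set 'rV[R]_n)
    (f : 'rV[R]_n -> 'rV[R]_n) : Prop :=
  [/\ C1_on A f,
      open (f @` A)
    & exists g : 'rV[R]_n -> 'rV[R]_n,
        (forall x, A x -> g (f x) = x) /\ C1_on (f @` A) g].

(* General solution of x_(k+1) = G (x_k, u_k); the control is only given on
   the k time steps 0, ..., k - 1 it is needed for. *)
Fixpoint gensol (T U : Type) (G : T -> U -> T) (k : nat) (x0 : T) :
    ('I_k -> U) -> T :=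
  match k with
  | 0 => fun _ => x0
  | k'.+1 => fun u =>
      G (gensol G x0 (fun i => u (widen_ord (leqnSn k') i))) (u ord_max)
  end.

Definition attainable (T U : Type) (G : T -> U -> T) (k : nat) (A : set T)
    (u : 'I_k -> U) : set T :=
  [set gensol G x u | x in A].

Definition affset (R : realType) (n : nat) (z : 'rV[R]_n) (l : R)
    (Y : set 'rV[R]_n) : set 'rV[R]_n :=
  [set z + l *: y | y in Y].

Definition sumset (R : realType) (n : nat) (Z : set 'rV[R]_n) (l : R)
    (Y : set 'rV[R]_n) : set 'rV[R]_n :=
  [set z + l *: y | z in Z & y in Y].

(* Main.v *)
Require Import Defs.
From HB Require Import structures.
From mathcomp Require Import all_boot all_order all_algebra.
From mathcomp Require Import all_classical all_reals all_analysis.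
From mathcomp Require Import ring lra.
Import Order.TTheory GRing.Theory Num.Theory.
Import numFieldNormedType.Exports.
Local Open Scope classical_set_scope.
Local Open Scope ring_scope.

(** The cells are small copies of Y, each contained in a small Euclidean ball.
    Balls of small radius have convex images under C^{1,1} diffeomorphisms
    (Polyak), so that ball can be taken as the superset of the cell; strong
    convexity of Yhat enters as boundedness.

    Convexity of the images.  For a C^{1,1} map f the defect
    f (t p + (1 - t) q) - (t f p + (1 - t) f q) is O(t (1 - t) |p - q|^2)
    ([C11_quasi_affine_near]).  If g is a local inverse of f that is Lipschitz,
    then g has a defect of the same order ([quasi_affine_near_inverse]), and
    being Lipschitz with such a defect is stable under composition
    ([quasi_affine_near_comp]).  Hence every solution map has local inverses with
    quadratic defect, without any derivative of a composite map being computed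
    ([gensol_regular_germ]).  Now let a, b lie in a ball of radius e and let m
    be a convex combination of f a and f b.  The point z = g m satisfies f z = m
    and lies within M t (1 - t) |a - b|^2 of t a + (1 - t) b, whereas that point
    is at depth at least t (1 - t) |a - b|^2 / (2 e) inside the ball.  For small
    e the point z is therefore in the ball, so m is in the image of the ball
    ([regular_germ_convex_ball]).  Compactness of K and finiteness of U make e
    uniform ([near_convex_attainable]).

    Covering.  With y0 interior to Y, the interiors of the cells
    x - lambda y0 + lambda Y, for x in K, cover K; finitely many of them suffice.
    The rest of the space is covered by the polyhedra obtained by choosing one
    face of each cell and reversing its inequality ([complement_coverP]).  Such a
    polyhedron misses the interior of every cell
    ([complement_cover_disjoint]), hence also misses K. *)

Set Implicit Arguments.
Unset Strict Implicit.
Unset Printing Implicit Defensive.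

(** * Maps with quadratic affinity defect *)

Lemma coord_le_norm (R : realType) (m n : nat) (A : 'M[R]_(m, n)) i j :
  `|A i j| <= `|A|.
Proof.
by rewrite [leRHS]mx_normrE; exact: (le_bigmax 0 (fun k => `|A k.1 k.2|) (i, j)).
Qed.

Lemma norm_le_coord (R : realType) (m n : nat) (A : 'M[R]_(m, n)) e :
  0 <= e -> (forall i j, `|A i j| <= e) -> `|A| <= e.
Proof. by move=> e0 Ae; rewrite [leLHS]mx_normrE; exact: bigmax_le. Qed.

Lemma norm_mulmx_coord (R : realType) (n : nat) (v : 'rV[R]_n) (A : 'M[R]_n) i j :
  `|(v *m A) i j| <= n%:R * (`|A| * `|v|).
Proof.
rewrite mxE (le_trans (ler_norm_sum _ _ _))//.
rewrite -[n in n%:R]card_ord mulr_natl -sumr_const ler_sum// => k _.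
by rewrite normrM mulrC ler_pM// coord_le_norm.
Qed.

(** Stated apart from the derivatives it is used for, because unification
    involving jacobians is prohibitively slow. *)
Lemma mulmxB_coord (R : realType) (n : nat) (v : 'rV[R]_n) (A B : 'M[R]_n) i j :
  (v *m (A - B)) i j = (v *m A) i j - (v *m B) i j.
Proof. by rewrite mulmxBr [LHS]mxE [X in _ + X]mxE. Qed.

(** The weight is an arbitrary real here, so that it can be a variable of
    ring identities. *)
Definition conv_comb (R : realType) (n : nat) (t : R) (p q : 'rV[R]_n) :=
  t *: p + (1 - t) *: q.

Definition lipschitz_near (R : realType) (n : nat) (C : R)
    (f : 'rV[R]_n -> 'rV[R]_n) (x : 'rV[R]_n) : Prop :=
  \forall p \near x & q \near x, `|f p - f q| <= C * `|p - q|.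

(** The factor t (1 - t) matters: it is matched against the depth of a point of a
    chord inside a ball, which vanishes at the ends of the chord. *)
Definition quasi_affine_near (R : realType) (n : nat) (C : R)
    (f : 'rV[R]_n -> 'rV[R]_n) (x : 'rV[R]_n) : Prop :=
  \forall p \near x & q \near x, forall t, 0 <= t <= 1 ->
    `|f (conv_comb t p q) - conv_comb t (f p) (f q)|
      <= C * (t * (1 - t) * `|p - q| ^+ 2).

Lemma is_derive_line_coord (R : realType) (n : nat)
    (f : 'rV[R]_n -> 'rV[R]_n) (a v : 'rV[R]_n) (s : R) (i : 'I_n) :
  differentiable f (a + s *: v) ->
  is_derive s 1 (fun r : R => f (a + r *: v) 0 i)
    ((v *m jacobian f (a + s *: v)) 0 i).
Proof.
move=> df; have /(_ v) dv := @diff_derivable _ _ _ f (a + s *: v) _ df.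
have H : h^-1 *: (f (a + (h *: 1 + s) *: v) 0 i - f (a + s *: v) 0 i : R)
    @[h --> 0^'] --> (v *m jacobian f (a + s *: v)) 0 i.
  rewrite -deriveEjacobian//.
  have := cvg_comp _ _ dv (@coord_continuous R 1 n 0 i _).
  apply: cvg_trans; apply: near_eq_cvg; near=> h => /=.
  by rewrite !mxE /= addrCA scalerDl [h *: 1]mulr1.
split; first by apply/cvg_ex; eexists; exact: H.
exact/cvg_lim.
Unshelve. all: by end_near. Qed.

Lemma mean_value_line_coord (R : realType) (n : nat)
    (f : 'rV[R]_n -> 'rV[R]_n) (a v : 'rV[R]_n) (s1 s2 : R) (i : 'I_n) :
  s1 <= s2 ->
  (forall s, s1 <= s <= s2 -> differentiable f (a + s *: v)) ->
  exists2 s, s1 <= s <= s2 &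
    f (a + s2 *: v) 0 i - f (a + s1 *: v) 0 i =
    (v *m jacobian f (a + s *: v)) 0 i * (s2 - s1).
Proof.
move=> s12 df.
have dphi s : s1 <= s <= s2 ->
    is_derive s 1 (fun r : R => f (a + r *: v) 0 i)
      ((v *m jacobian f (a + s *: v)) 0 i).
  by move=> s12'; exact/is_derive_line_coord/df.
have [||s s12' ->] := @MVT_segment R (fun r : R => f (a + r *: v) 0 i)
    (fun s => (v *m jacobian f (a + s *: v)) 0 i) s1 s2 s12.
- by move=> s; rewrite in_itv/= => /andP[s1s ss2]; apply: dphi; rewrite !ltW.
- apply: derivable_within_continuous => s; rewrite in_itv/= => /dphi.
  by case.
by exists s.
Qed.

Lemma near2_map (R : realType) (n : nat) (f : 'rV[R]_n -> 'rV[R]_n)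
    (x y : 'rV[R]_n) (P : 'rV[R]_n -> 'rV[R]_n -> Prop) :
  f z @[z --> x] --> y ->
  (\forall p \near y & q \near y, P p q) ->
  \forall p \near x & q \near x, P (f p) (f q).
Proof.
move=> fxy [[A B] [/= yA yB] AB]; exists (f @^-1` A, f @^-1` B) => /=.
  by split; apply: fxy.
by move=> [p q] [/= Afp Bfq]; exact: (AB (f p, f q)).
Qed.

Lemma near_pair (R : realType) (n : nat) (x : 'rV[R]_n)
    (P : 'rV[R]_n -> Prop) :
  (\near x, P x) -> \forall p \near x & q \near x, P p /\ P q.
Proof. by move=> xP; exists (P, P). Qed.

Lemma near2_diag (R : realType) (n : nat) (x : 'rV[R]_n)
    (P : 'rV[R]_n -> 'rV[R]_n -> Prop) :
  (\forall p \near x & q \near x, P p q) ->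
  exists2 W, nbhs x W & forall p q, W p -> W q -> P p q.
Proof.
move=> [[A B] [/= xA xB] AB]; exists (A `&` B); first exact: filterI.
by move=> p q [Ap _] [_ Bq]; exact: (AB (p, q)).
Qed.

(** Balls are convex. *)
Lemma near_conv_comb (R : realType) (n : nat) (x : 'rV[R]_n)
    (P : 'rV[R]_n -> Prop) :
  (\near x, P x) ->
  \forall p \near x & q \near x, forall t, 0 <= t <= 1 -> P (conv_comb t p q).
Proof.
move=> /nbhs_ballP[e /= e0 eP].
exists (ball x e, ball x e) => /=; first by split; exact: nbhsx_ballx.
move=> [p q] [/=]; rewrite -ball_normE /= => xp xq t /andP[t0 t1].
apply: eP; rewrite -ball_normE /= /conv_comb.
have -> : x - (t *: p + (1 - t) *: q) = t *: (x - p) + (1 - t) *: (x - q).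
  by rewrite !scalerBr addrACA -scalerDl subrKC scale1r -opprD.
rewrite (le_lt_trans (ler_normD _ _))// !normrZ (ger0_norm t0) ger0_norm ?subr_ge0//.
have [->|tn0] := eqVneq t 0; first by rewrite mul0r add0r subr0 mul1r.
rewrite (@lt_le_trans _ _ (t * e + (1 - t) * e))//; last first.
  by rewrite -mulrDl subrKC mul1r.
apply: ltr_leD; last by rewrite ler_wpM2l ?subr_ge0// ltW.
by rewrite ltr_pM2l// lt_neqAle eq_sym tn0.
Qed.

Lemma lipschitz_near_cvg (R : realType) (n : nat) (C : R)
    (f : 'rV[R]_n -> 'rV[R]_n) (x : 'rV[R]_n) :
  lipschitz_near C f x -> f z @[z --> x] --> f x.
Proof.
move=> /near2_diag[W xW fW].
apply: (iffRL (@cvgrPdist_lt R 'rV[R]_n _ (nbhs x) _ f (f x))) => e e0.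
have C0 : 0 < `|C| + 1 by rewrite ltr_wpDl.
near=> z.
apply: le_lt_trans (fW _ _ (nbhs_singleton xW) _) _; first by near: z.
have : `|x - z| < e / (`|C| + 1).
  by near: z; apply: cvgr_dist_lt => //; rewrite divr_gt0.
rewrite ltr_pdivlMr// mulrC; apply: le_lt_trans.
by rewrite ler_wpM2r// (le_trans (ler_norm C))// lerDl.
Unshelve. all: by end_near. Qed.

(** The mean value theorem, coordinate by coordinate, on a neighborhood where the
    jacobian is bounded. *)
Lemma C1_lipschitz_near (R : realType) (n : nat) (A : set 'rV[R]_n)
    (f : 'rV[R]_n -> 'rV[R]_n) (x : 'rV[R]_n) :
  open A -> C1_on A f -> A x -> exists2 C, 0 <= C & lipschitz_near C f x.
Proof.
move=> oA [df]; rewrite continuous_open_subspace// => cJ Ax.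
have {}cJ : jacobian f z @[z --> x] --> jacobian f x by apply: cJ; rewrite inE.
pose M := `|jacobian f x| + 1.
exists (n%:R * M); first by rewrite mulr_ge0// addr_ge0.
have JM : \forall z \near x, A z /\ `|jacobian f z| <= M.
  near=> z; split; first by near: z; exact: open_nbhs_nbhs.
  rewrite /M -lerBlDl (le_trans (lerB_dist _ _))// distrC ltW//.
  by near: z; exact: cvgr_dist_lt.
apply: filterS (near_conv_comb JM) => -[p q] /= JMpq.
have H t : 0 <= t <= 1 -> A (q + t *: (p - q)) /\ `|jacobian f (q + t *: (p - q))| <= M.
  move=> t01; have -> : q + t *: (p - q) = conv_comb t p q.
    by rewrite /conv_comb scalerBr scalerBl scale1r addrCA.
  exact: JMpq.
apply: norm_le_coord => [|i j]; first by rewrite !mulr_ge0// addr_ge0.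
have [s s01] := @mean_value_line_coord R n f q (p - q) 0 1 j ler01
  (fun s s01 => df _ (H s s01).1).
rewrite scale1r scale0r addr0 subr0 mulr1 subrKC.
have -> : (f p - f q) i j = f p 0 j - f q 0 j by rewrite !mxE ord1.
move=> ->; rewrite (le_trans (norm_mulmx_coord _ _ _ _))// -mulrA ler_wpM2l// ler_wpM2r//.
exact: (H s s01).2.
Unshelve. all: by end_near. Qed.

(** Along the segment from q to p the defect is a weighted difference of the
    increments of f over the two parts; the mean value theorem on each part turns it
    into t (1 - t) times a difference of two values of the derivative, which the
    Lipschitz condition bounds. *)
Lemma C11_quasi_affine_near (R : realType) (n : nat) (A : set 'rV[R]_n)
    (f : 'rV[R]_n -> 'rV[R]_n) (x : 'rV[R]_n) :
  open A -> C11_on A f -> A x -> exists2 C, 0 <= C & quasi_affine_near C f x.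
Proof.
move=> oA [[df _] lJ] Ax.
have [M M0 JM] : exists2 M, 0 <= M & \forall z \near x & w \near x,
    A z /\ A w /\ `|jacobian f z - jacobian f w| <= M * `|z - w|.
  have := lJ (x, x) (conj Ax Ax); rewrite /lipschitz_on => lJx.
  (* The Lipschitz hypothesis concerns pairs of points, and is used at the
     diagonal point (x, x). *)
  have [M [M0 JM]] := @filter_ex _ _ _ _ (filterI (nbhs_pinfty_ge (num_real 0)) lJx).
  exists M => //.
  have AA : \near x, A x by exact: open_nbhs_nbhs.
  apply: filterS2 (near_pair AA) JM => -[z w] /= [Az Aw] h.
  by split=> //; split=> //; exact: h.
have [W xW {}JM] := near2_diag JM.
exists (n%:R * M); first by rewrite mulr_ge0.
apply: filterS (near_conv_comb xW) => -[p q] /= Wpq t /andP[t0 t1].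
have cE s : conv_comb s p q = q + s *: (p - q).
  by rewrite /conv_comb scalerBr scalerBl scale1r addrCA.
have {}Wpq s : 0 <= s <= 1 -> W (q + s *: (p - q)).
  by move=> s01; rewrite -cE; exact: Wpq.
have dfs s : 0 <= s <= 1 -> differentiable f (q + s *: (p - q)).
  by move=> /Wpq Ws; apply: df; have [] := JM _ _ Ws Ws.
apply: norm_le_coord => [|i j].
  by rewrite !mulr_ge0// subr_ge0.
have [|s1 /andP[s10 s1t]] := @mean_value_line_coord R n f q (p - q) 0 t j t0.
  by move=> s /andP[s0 st]; apply: dfs; rewrite s0 (le_trans st).
have [|s2 /andP[s2t s21]] := @mean_value_line_coord R n f q (p - q) t 1 j t1.
  by move=> s /andP[ts s1']; apply: dfs; rewrite s1' (le_trans t0).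
rewrite scale1r scale0r addr0 subr0 subrKC => E2 E1.
have s101 : 0 <= s1 <= 1 by rewrite s10 (le_trans s1t).
have s201 : 0 <= s2 <= 1 by rewrite s21 (le_trans t0).
set J1 := jacobian f (q + s1 *: (p - q)) in E1.
set J2 := jacobian f (q + s2 *: (p - q)) in E2.
have alg (ft fq fp d1 d2 : R) : ft - fq = d1 * t -> fp - ft = d2 * (1 - t) ->
    ft - (t * fp + (1 - t) * fq) = t * (1 - t) * (d1 - d2).
  by move=> /(canRL (subrK _)) e1 /(canRL (subrK _)) ->; rewrite e1; ring.
have -> : (f (conv_comb t p q) - conv_comb t (f p) (f q)) i j =
    t * (1 - t) * ((p - q) *m (J1 - J2)) 0 j.
  rewrite mulmxB_coord.
  have -> : (f (conv_comb t p q) - conv_comb t (f p) (f q)) i j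
      = f (q + t *: (p - q)) 0 j - (t * f p 0 j + (1 - t) * f q 0 j).
    by rewrite cE /conv_comb !mxE ord1.
  exact: alg E1 E2.
have [_ [_ J12]] := JM _ _ (Wpq _ s101) (Wpq _ s201).
have -> : n%:R * M * (t * (1 - t) * `|p - q| ^+ 2)
    = t * (1 - t) * (n%:R * (M * `|p - q| * `|p - q|)) by ring.
have t1t : 0 <= t * (1 - t) by rewrite mulr_ge0 ?subr_ge0.
rewrite normrM (ger0_norm t1t) ler_wpM2l//.
rewrite (le_trans (norm_mulmx_coord _ _ _ _))// ler_wpM2l// ler_wpM2r//.
rewrite (le_trans J12)// ler_wpM2l//.
rewrite opprD addrACA subrr add0r -scalerBl normrZ ler_piMl// ler_norml.
move: s10 s1t s2t s21; clear; move=> ? ? ? ?.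
by apply/andP; split; lra.
Qed.

Lemma lipschitz_near_comp (R : realType) (n : nat) (C D : R)
    (f g : 'rV[R]_n -> 'rV[R]_n) (x : 'rV[R]_n) :
  0 <= D -> lipschitz_near C f x -> lipschitz_near D g (f x) ->
  lipschitz_near (D * C) (g \o f) x.
Proof.
move=> D0 fC gD; have fx := lipschitz_near_cvg fC.
apply: filterS2 fC (near2_map fx gD) => -[p q] /= fpq gpq.
by rewrite (le_trans gpq)// -mulrA ler_wpM2l.
Qed.

(** The defect of the composite is that of g between f p and f q, plus the image
    under the Lipschitz map g of the defect of f. *)
Lemma quasi_affine_near_comp (R : realType) (n : nat) (C C' D D' : R)
    (f g : 'rV[R]_n -> 'rV[R]_n) (x : 'rV[R]_n) :
  0 <= C -> 0 <= D -> 0 <= D' ->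
  lipschitz_near C f x -> quasi_affine_near C' f x ->
  lipschitz_near D g (f x) -> quasi_affine_near D' g (f x) ->
  quasi_affine_near (D * C' + D' * C ^+ 2) (g \o f) x.
Proof.
move=> C0 D0 D'0 fC fC' /near2_diag[W xW gD] gD'.
have fx := lipschitz_near_cvg fC.
have Wf := near_conv_comb (fx _ xW).
have fW := near2_map fx (near_conv_comb xW).
apply: filterS3 (filterI fC fC') (filterI Wf fW) (near2_map fx gD').
move=> -[p q] /= [fpq fpq'] [Wfpq fWpq] gpq t t01.
have t1t : 0 <= t * (1 - t) by case/andP: t01 => ? ?; rewrite mulr_ge0 ?subr_ge0.
apply: le_trans (ler_distD (g (conv_comb t (f p) (f q))) _ _) _.
rewrite mulrDl lerD//.
  by rewrite (le_trans (gD _ _ (Wfpq t t01) (fWpq t t01)))// -mulrA ler_wpM2l// fpq'.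
have -> : D' * C ^+ 2 * (t * (1 - t) * `|p - q| ^+ 2)
    = D' * (t * (1 - t) * (C * `|p - q|) ^+ 2) by ring.
rewrite (le_trans (gpq t t01))// ler_wpM2l// ler_wpM2l//.
by rewrite lerXn2r ?nnegrE ?mulr_ge0.
Qed.

Definition inverse_germ (R : realType) (n : nat)
    (f g : 'rV[R]_n -> 'rV[R]_n) (x : 'rV[R]_n) : Prop :=
  (\forall p \near x, g (f p) = p) /\ (\forall p \near f x, f (g p) = p).

(** The map f sends t (g p) + (1 - t) (g q) to within O(t (1 - t) |g p - g q|^2) of
    t p + (1 - t) q; applying the Lipschitz map g to both points gives the bound. *)
Lemma quasi_affine_near_inverse (R : realType) (n : nat) (C C' D : R)
    (f g : 'rV[R]_n -> 'rV[R]_n) (x : 'rV[R]_n) :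
  0 <= C' -> 0 <= D -> inverse_germ f g x ->
  lipschitz_near C f x -> quasi_affine_near C' f x -> lipschitz_near D g (f x) ->
  quasi_affine_near (D * C' * D ^+ 2) g (f x).
Proof.
move=> C'0 D0 [gf fg] fC fC' gD.
have fx := lipschitz_near_cvg fC.
have gx := lipschitz_near_cvg gD; rewrite (nbhs_singleton gf) in gx.
have [W xW gDW] := near2_diag gD.
have A1 := near2_map gx fC'.
have gfW : \forall p \near x, g (f p) = p /\ W (f p).
  by apply: filterI => //; exact: fx.
have A2 := near2_map gx (near_conv_comb gfW).
apply: filterS3 (filterI (near_pair fg) gD) (filterI A1 A2) (near_conv_comb xW).
move=> -[p q] /= [[fgp fgq] gpq] [fpq' gfpq] Wpq t t01.
have t1t : 0 <= t * (1 - t) by case/andP: t01 => ? ?; rewrite mulr_ge0 ?subr_ge0.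
have [E Wf] := gfpq t t01.
rewrite -{1}E (le_trans (gDW _ _ (Wpq t t01) Wf))//.
have -> : D * C' * D ^+ 2 * (t * (1 - t) * `|p - q| ^+ 2)
    = D * (C' * (t * (1 - t) * (D * `|p - q|) ^+ 2)) by ring.
rewrite ler_wpM2l// distrC.
have := fpq' t t01; rewrite fgp fgq => /le_trans; apply.
by rewrite ler_wpM2l// ler_wpM2l// lerXn2r ?nnegrE ?mulr_ge0.
Qed.

(** What the convexity argument needs from f near x, in a form that is stable under
    composition. *)
Definition regular_germ (R : realType) (n : nat)
    (f : 'rV[R]_n -> 'rV[R]_n) (x : 'rV[R]_n) : Prop :=
  (exists2 C, 0 <= C & lipschitz_near C f x) /\
  exists g, [/\ inverse_germ f g x,
    (exists2 C, 0 <= C & lipschitz_near C g (f x))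
    & (exists2 C, 0 <= C & quasi_affine_near C g (f x))].

Lemma regular_germ_id (R : realType) (n : nat) (x : 'rV[R]_n) :
  regular_germ id x.
Proof.
have lid : exists2 C, 0 <= C & lipschitz_near C (@id 'rV[R]_n) x.
  by exists 1 => //; apply: filterE => -[p q] /=; rewrite mul1r.
split=> //; exists id; split=> //; first by split; exact: filterE.
exists 0 => //; apply: filterE => -[p q] t _ /=.
by rewrite subrr normr0 mul0r.
Qed.

Lemma regular_germ_comp (R : realType) (n : nat)
    (f1 f2 : 'rV[R]_n -> 'rV[R]_n) (x : 'rV[R]_n) :
  regular_germ f1 x -> regular_germ f2 (f1 x) -> regular_germ (f2 \o f1) x.
Proof.
move=> [[C1 C10 l1] [g1 [[g1f1 f1g1] [D1 D10 lg1] [E1 E10 qg1]]]].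
move=> [[C2 C20 l2] [g2 [[g2f2 f2g2] [D2 D20 lg2] [E2 E20 qg2]]]].
have f1x := lipschitz_near_cvg l1.
have g2x := lipschitz_near_cvg lg2.
have E := nbhs_singleton g2f2.
rewrite E in g2x; rewrite -E in lg1 qg1.
split.
  by exists (C2 * C1); [exact: mulr_ge0|exact: lipschitz_near_comp].
exists (g1 \o g2); split.
- split=> /=.
    by apply: filterS2 g1f1 (f1x _ g2f2) => p /= + ->.
  by apply: filterS2 f2g2 (g2x _ f1g1) => p /= + ->.
- by exists (D1 * D2); [exact: mulr_ge0|exact: lipschitz_near_comp].
- exists (D1 * E2 + E1 * D2 ^+ 2).
    by rewrite addr_ge0 ?mulr_ge0 ?exprn_ge0.
  exact: quasi_affine_near_comp.
Qed.

Lemma C11_diffeo_regular_germ (R : realType) (n : nat) (X : set 'rV[R]_n)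
    (f : 'rV[R]_n -> 'rV[R]_n) (x : 'rV[R]_n) :
  open X -> C1_diffeo_on X f -> C11_on X f -> X x -> regular_germ f x.
Proof.
move=> oX [C1f ofX [g [gf C1g]]] C11f Xx.
have [C C0 lf] := C1_lipschitz_near oX C1f Xx.
have fXfx : (f @` X) (f x) by exists x.
have [D D0 lg] := C1_lipschitz_near ofX C1g fXfx.
have [C' C'0 qf] := C11_quasi_affine_near oX C11f Xx.
have ig : inverse_germ f g x.
  split; first by apply: filterS (open_nbhs_nbhs (conj oX Xx)).
  by apply: filterS (open_nbhs_nbhs (conj ofX fXfx)) => _ [z Xz <-]; rewrite gf.
split; first by exists C.
exists g; split=> //; first by exists D.
exists (D * C' * D ^+ 2); first by rewrite !mulr_ge0.
exact: quasi_affine_near_inverse lf qf lg.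
Qed.

Lemma gensol_regular_germ (R : realType) (n : nat) (X : set 'rV[R]_n)
    (U : Type) (G : 'rV[R]_n -> U -> 'rV[R]_n) :
  open X -> (forall x w, X x -> X (G x w)) ->
  (forall w, C1_diffeo_on X (G^~ w)) -> (forall w, C11_on X (G^~ w)) ->
  forall k (u : 'I_k -> U) x, X x ->
    X (gensol G x u) /\ regular_germ (fun z => gensol G z u) x.
Proof.
move=> oX GX dG cG; elim=> [|k IH] u x Xx /=.
  by split=> //; exact: regular_germ_id.
have [Xk rk] := IH (fun i => u (widen_ord (leqnSn k) i)) x Xx.
split; first exact: GX.
apply: (regular_germ_comp rk (f2 := G^~ (u ord_max))).
exact: C11_diffeo_regular_germ (dG _) (cG _) _.
Qed.

(** * Convexity of the images of small balls *)

(** Strong convexity of the squared Euclidean distance. *)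
Lemma dotv_conv_comb (R : realType) (n : nat) (t : R) (p q x : 'rV[R]_n) :
  dotv (conv_comb t p q - x) (conv_comb t p q - x) =
  t * dotv (p - x) (p - x) + (1 - t) * dotv (q - x) (q - x)
  - t * (1 - t) * dotv (p - q) (p - q).
Proof.
rewrite /dotv !mulr_sumr -sumrN -!big_split; apply: eq_bigr => i _ /=.
by rewrite /conv_comb !mxE; ring.
Qed.

Lemma dotvDD (R : realType) (n : nat) (x y : 'rV[R]_n) :
  dotv (x + y) (x + y) = dotv x x + dotv x y *+ 2 + dotv y y.
Proof.
rewrite /dotv -sumrMnl -!big_split; apply: eq_bigr => i _ /=.
by rewrite !mxE; ring.
Qed.

Lemma dotv_ge0 (R : realType) (n : nat) (x : 'rV[R]_n) : 0 <= dotv x x.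
Proof. by apply: sumr_ge0 => i _; rewrite -expr2 sqr_ge0. Qed.

Lemma norm_dotv_le (R : realType) (n : nat) (x y : 'rV[R]_n) :
  `|dotv x y| <= n%:R * (`|x| * `|y|).
Proof.
rewrite (le_trans (ler_norm_sum _ _ _))//.
rewrite -[n in n%:R]card_ord mulr_natl -sumr_const ler_sum// => k _.
by rewrite normrM ler_pM// coord_le_norm.
Qed.

Lemma norm_sqr_le_dotv (R : realType) (n : nat) (x : 'rV[R]_n) :
  `|x| ^+ 2 <= dotv x x.
Proof.
rewrite -(sqr_sqrtr (dotv_ge0 x)) lerXn2r ?nnegrE ?sqrtr_ge0//.
apply: norm_le_coord => [|i j]; first exact: sqrtr_ge0.
rewrite (ord1 i) -sqrtr_sqr ler_sqrt ?dotv_ge0// /dotv (bigD1 j)//= expr2 lerDl.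
by rewrite sumr_ge0// => k _; rewrite -expr2 sqr_ge0.
Qed.

Lemma eballE (R : realType) (n : nat) (c : 'rV[R]_n) (r : R) (x : 'rV[R]_n) :
  0 <= r -> eball c r x <-> dotv (x - c) (x - c) <= r ^+ 2.
Proof.
move=> r0; rewrite /eball /= -[X in Num.sqrt _ <= X](ger0_norm r0) -sqrtr_sqr.
by rewrite ler_sqrt ?sqr_ge0.
Qed.

Lemma eball_norm (R : realType) (n : nat) (c : 'rV[R]_n) (r : R) (x : 'rV[R]_n) :
  eball c r x -> `|x - c| <= r.
Proof.
move=> xr; have r0 : 0 <= r by apply: le_trans xr; exact: sqrtr_ge0.
move/eballE : xr => /(_ r0) /(le_trans (norm_sqr_le_dotv _)).
by rewrite ler_pXn2r ?nnegrE.
Qed.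

(** The factor n, rather than its square root, is enough to compare the sup norm
    with the Euclidean one. *)
Lemma norm_eball (R : realType) (n : nat) (c : 'rV[R]_n) (r : R) (x : 'rV[R]_n) :
  `|x - c| <= r -> eball c (n%:R * r) x.
Proof.
move=> xr; have r0 : 0 <= r by exact: le_trans xr.
apply/eballE; first by rewrite mulr_ge0.
rewrite (le_trans (ler_norm _))// (le_trans (norm_dotv_le _ _))//.
rewrite exprMn expr2 -mulrA ler_wpM2l// expr2.
case: n c x xr => [|n] c x xr; first by rewrite mul0r// thinmx0 normr0 mul0r.
by apply: (@le_trans _ _ (r * r)); rewrite ?ler_peMl ?mulr_ge0 ?ler1n// ler_pM.
Qed.

(** The point z is the image of conv_comb t (f p) (f q) under the local inverse. *)
Lemma regular_germ_conv_comb (R : realType) (n : nat)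
    (f : 'rV[R]_n -> 'rV[R]_n) (x : 'rV[R]_n) :
  regular_germ f x ->
  exists2 M, 0 <= M & \forall p \near x & q \near x, forall t, 0 <= t <= 1 ->
    exists2 z, f z = conv_comb t (f p) (f q) &
      `|z - conv_comb t p q| <= M * (t * (1 - t) * `|p - q| ^+ 2).
Proof.
move=> [[C C0 lf] [g [[gf fg] _ [D D0 qg]]]].
have fx := lipschitz_near_cvg lf.
exists (D * C ^+ 2); first by rewrite mulr_ge0 ?exprn_ge0.
have A1 := near2_map fx qg.
have A2 := near2_map fx (near_conv_comb fg).
apply: filterS3 (filterI (near_pair gf) lf) A1 A2.
move=> -[p q] /= [[gfp gfq] lpq] qpq fgpq t t01.
have t1t : 0 <= t * (1 - t) by case/andP: t01 => ? ?; rewrite mulr_ge0 ?subr_ge0.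
exists (g (conv_comb t (f p) (f q))); first exact: fgpq.
have := qpq t t01; rewrite gfp gfq => /le_trans; apply.
have -> : D * C ^+ 2 * (t * (1 - t) * `|p - q| ^+ 2)
    = D * (t * (1 - t) * (C * `|p - q|) ^+ 2) by ring.
by rewrite ler_wpM2l// ler_wpM2l// lerXn2r ?nnegrE ?mulr_ge0.
Qed.

(** Balls centered near x0, not only at x0, are needed to make the radius uniform on
    a compact set. *)
Lemma near_eball (R : realType) (n : nat) (x0 : 'rV[R]_n) (A : set 'rV[R]_n) :
  nbhs x0 A -> \forall x \near x0 & e \near (0 : R)^'+, eball x e `<=` A.
Proof.
move=> /nbhs_ballP[e /= e0 eA].
exists (ball x0 (e / 2), [set r | r <= e / 4]) => /=.
  split; first by apply: nbhsx_ballx; rewrite divr_gt0.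
  by apply: nbhs_right_le; rewrite divr_gt0.
move=> [x r] /= [xe re] z /eball_norm zx; apply: eA.
move: xe; rewrite -!ball_normE /= => xe.
apply: le_lt_trans (ler_distD x _ _) _; rewrite (distrC x z).
move: xe re zx; move: (`|x0 - x|) (`|z - x|) => a b; lra.
Qed.

(** Write S for t (1 - t) |p - q|^2 in the Euclidean norm.  The convex combination c
    of p and q satisfies |c - x|^2 <= e^2 - S, and z is within M S of c in the sup
    norm, so |z - x|^2 <= e^2 - S + 2 n e M S + n (M S)^2.  As S <= e^2, the last two
    terms are at most S once e <= 1 and e (n (2 M + M^2)) <= 1. *)
Lemma regular_germ_convex_ball (R : realType) (n : nat)
    (f : 'rV[R]_n -> 'rV[R]_n) (x0 : 'rV[R]_n) :
  regular_germ f x0 ->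
  \forall x \near x0 & e \near (0 : R)^'+,
    @convex_set R 'rV[R]_n [set f z | z in eball x e].
Proof.
move=> /regular_germ_conv_comb[M M0 /near2_diag[W xW fW]].
(* The summand 1 keeps L positive when M vanishes. *)
pose L := n%:R * (2 * M + M ^+ 2) + 1.
have L0 : 0 < L by rewrite ltr_wpDl// mulr_ge0// addr_ge0 ?sqr_ge0 ?mulr_ge0.
have small : \forall x \near x0 & e \near (0 : R)^'+, 0 < e /\ e <= 1 /\ e * L <= 1.
  exists (setT, [set e | 0 < e /\ e <= 1 /\ e * L <= 1]) => /=; last by move=> [x e] [].
  split; first exact: filterT.
  apply: filterS3 (nbhs_right_gt 0) (nbhs_right_le ltr01) (@nbhs_right_le R 0 (L^-1) _).
    by move=> e e0 e1; rewrite /= -[L^-1]mul1r ler_pdivlMr.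
  by rewrite invr_gt0.
apply: filterS2 small (near_eball xW) => -[x e] /= [e0 [e1 eL]] xeW.
move=> y1 y2 l; rewrite !inE /= => -[p pe <-] [q qe <-].
have l01 : 0 <= l%:num <= 1 by rewrite ge0 le1.
have [z fz zc] := fW _ _ (xeW _ pe) (xeW _ qe) _ l01.
exists z; last exact: fz.
move: l%:num l01 zc {fz} => t /andP[t0 t1] zc.
apply: (eballE x z (ltW e0)).2.
have {}pe := (eballE x p (ltW e0)).1 pe; have {}qe := (eballE x q (ltW e0)).1 qe.
have t1t : 0 <= t * (1 - t) by rewrite mulr_ge0 ?subr_ge0.
pose S := t * (1 - t) * dotv (p - q) (p - q).
have S0 : 0 <= S by rewrite mulr_ge0// dotv_ge0.
have cS : dotv (conv_comb t p q - x) (conv_comb t p q - x) <= e ^+ 2 - S.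
  rewrite dotv_conv_comb -/S lerB//.
  have -> : e ^+ 2 = t * e ^+ 2 + (1 - t) * e ^+ 2 by ring.
  by rewrite lerD// ler_wpM2l// subr_ge0.
have Se : S <= e ^+ 2 by rewrite -subr_ge0 (le_trans (dotv_ge0 _) cS).
have zcS : `|z - conv_comb t p q| <= M * S.
  by rewrite (le_trans zc)// ler_wpM2l// ler_wpM2l// norm_sqr_le_dotv.
have ce : `|conv_comb t p q - x| <= e.
  have : `|conv_comb t p q - x| ^+ 2 <= e ^+ 2.
    by rewrite (le_trans (norm_sqr_le_dotv _))// (le_trans cS)// gerBl.
  by rewrite ler_pXn2r ?nnegrE// ltW.
rewrite -(subrKA (conv_comb t p q)) addrC dotvDD.
have B : dotv (conv_comb t p q - x) (z - conv_comb t p q) <= n%:R * (e * (M * S)).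
  rewrite (le_trans (ler_norm _))// (le_trans (norm_dotv_le _ _))//.
  by rewrite ler_wpM2l// ler_pM.
have D : dotv (z - conv_comb t p q) (z - conv_comb t p q)
    <= n%:R * ((M * S) * (M * S)).
  rewrite (le_trans (ler_norm _))// (le_trans (norm_dotv_le _ _))//.
  by rewrite ler_wpM2l// ler_pM.
have F : (n%:R * (e * (M * S))) *+ 2 + n%:R * ((M * S) * (M * S)) <= S.
  have SS : S * S <= e * S.
    rewrite ler_wpM2r// (le_trans Se)// expr2 ler_piMl// ltW//.
  have nM : 0 <= n%:R * M ^+ 2 by rewrite mulr_ge0// sqr_ge0.
  have := ler_wpM2l nM SS.
  have := ler_wpM2r S0 eL.
  have := mulr_ge0 (ltW e0) S0.
  rewrite /L; move: (n%:R) => m; nra.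
move: cS B D F.
move: (dotv _ _) (dotv _ _) (dotv _ _) => a b c; lra.
Qed.

(** Each pair (k, u) gives a radius near every point of K; a near covering argument
    on the compact set K makes it uniform, and there are finitely many pairs once
    controls are represented as finite functions. *)
Lemma near_convex_attainable (R : realType) (n : nat) (X : set 'rV[R]_n)
    (U : finType) (G : 'rV[R]_n -> U -> 'rV[R]_n) (N : nat)
    (K : set 'rV[R]_n) :
  open X -> (forall x w, X x -> X (G x w)) ->
  (forall w, C1_diffeo_on X (G^~ w)) -> (forall w, C11_on X (G^~ w)) ->
  compact K -> K `<=` X ->
  \forall e \near (0 : R)^'+, forall x, K x ->
    forall (k : nat) (u : 'I_k -> U), (k <= N)%N ->
      @convex_set R 'rV[R]_n (attainable G (eball x e) u).
Proof.
move=> oX GX dG cG /compact_near_coveringP cK KX.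
have ku (k : 'I_N.+1) (u : {ffun 'I_k -> U}) : \forall e \near (0 : R)^'+,
    K `<=` [set x | @convex_set R 'rV[R]_n (attainable G (eball x e) u)].
  apply: cK => x /KX Xx.
  have [_ /regular_germ_convex_ball] := gensol_regular_germ oX GX dG cG u Xx.
  exact.
have allku : \forall e \near (0 : R)^'+, forall (k : 'I_N.+1) (u : {ffun 'I_k -> U}),
    K `<=` [set x | @convex_set R 'rV[R]_n (attainable G (eball x e) u)].
  by apply: filter_forall => k; apply: filter_forall => u; exact: ku.
apply: filterS allku => e eK x Kx k u; rewrite -ltnS => kN.
have -> : u = (finfun u : {ffun 'I_(Ordinal kN) -> U}).
  by apply/funext => i; rewrite ffunE.
exact: eK.
Qed.

(** * Polyhedra and coverings *)

(** A constraint (a, b) stands for the inequality dotv a x <= b; finite lists of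
    constraints make the complement of a union of polyhedra computable. *)
Definition polyhedron_of (R : realType) (n : nat) (s : seq ('rV[R]_n * R)) :
    set 'rV[R]_n := [set x | forall h, h \in s -> dotv h.1 x <= h.2].

Definition proper_constraints (R : realType) (n : nat)
    (s : seq ('rV[R]_n * R)) : Prop := forall h, h \in s -> h.1 != 0.

Lemma convex_polyhedronP (R : realType) (n : nat) (P : set 'rV[R]_n) :
  convex_polyhedron P <->
  exists2 s : seq ('rV[R]_n * R), proper_constraints s & P = polyhedron_of s.
Proof.
split=> [[F [/finite_seqP[t ->] Fh ->]]|[s s0 ->]].
  have /choice[h hP] : forall H : set 'rV[R]_n, exists h : 'rV[R]_n * R,
      H \in t -> h.1 != 0 /\ H = [set x | dotv h.1 x <= h.2].
    move=> H; have [Ht|Ht] := boolP (H \in t); last by exists (0, 0).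
    by have [a [b ab]] := Fh H Ht; exists (a, b).
  exists (map h t); first by move=> _ /mapP[H Ht ->]; exact: (hP H Ht).1.
  apply/seteqP; split=> x /= Px.
    move=> _ /mapP[H Ht ->]; have : H x by exact: Px.
    by rewrite {1}(hP H Ht).2.
  by move=> H Ht; rewrite [H](hP H Ht).2; apply: Px; exact: map_f.
exists [set [set x | dotv h.1 x <= h.2] | h in [set` s]]; split.
- by apply: finite_image; exact: finite_seq.
- by move=> _ [h hs <-]; exists h.1, h.2; split=> //; exact: s0.
- apply/seteqP; split=> x /= Px.
    by move=> _ [h hs <-]; exact: Px.
  by move=> h hs; apply: (Px [set x | dotv h.1 x <= h.2]); exists h.
Qed.

Lemma dotvDZr (R : realType) (n : nat) (a z y : 'rV[R]_n) (l : R) :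
  dotv a (z + l *: y) = dotv a z + l * dotv a y.
Proof.
rewrite /dotv mulr_sumr -big_split; apply: eq_bigr => i _ /=.
by rewrite !mxE; ring.
Qed.

Lemma affset_polyhedron_of (R : realType) (n : nat) (z : 'rV[R]_n) (l : R)
    (s : seq ('rV[R]_n * R)) : 0 < l ->
  affset z l (polyhedron_of s) = polyhedron_of [seq (h.1, dotv h.1 z + l * h.2) | h <- s].
Proof.
move=> l0; apply/seteqP; split=> [_ [y ys <-] _ /mapP[h hs ->]|x xs] /=.
  by rewrite dotvDZr lerD2l ler_pM2l// ys.
have xE : x = z + l *: (l^-1 *: (x - z)).
  by rewrite scalerA divff ?gt_eqF// scale1r subrKC.
exists (l^-1 *: (x - z)); last by rewrite -xE.
move=> h hs; have /= := xs _ (map_f _ hs).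
by rewrite {1}xE dotvDZr lerD2l ler_pM2l.
Qed.

(** Otherwise moving from x a little along the normal h.1 would leave the
    half-space. *)
Lemma interior_polyhedron_of (R : realType) (n : nat) (s : seq ('rV[R]_n * R)) x h :
  proper_constraints s -> (polyhedron_of s)° x -> h \in s -> dotv h.1 x < h.2.
Proof.
move=> s0 /nbhs_ballP[e /= e0 es] hs.
have h0 := s0 _ hs.
have nh : 0 < `|h.1| by rewrite normr_gt0.
have hh : 0 < dotv h.1 h.1.
  by rewrite (lt_le_trans _ (norm_sqr_le_dotv _))// exprn_gt0.
pose d := e / 2 / `|h.1|.
have d0 : 0 < d by rewrite !divr_gt0.
have /es/(_ h hs) : ball x e (x + d *: h.1).
  rewrite -ball_normE /= opprD addrA subrr add0r normrN normrZ gtr0_norm//.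
  by rewrite /d divfK ?gt_eqF// ltr_pdivrMr// ltr_pMr// ltr1n.
by rewrite dotvDZr; apply: lt_le_trans; rewrite ltrDl mulr_gt0.
Qed.

Definition reverse_constraint (R : realType) (n : nat) (h : 'rV[R]_n * R) := (- h.1, - h.2).

(** Distributivity: the complement of a union of polyhedra is the intersection over
    the polyhedra of the unions of their reversed constraints, that is, a union indexed
    by the choices of one constraint per polyhedron.  Relaxing the strict inequalities
    gives closed polyhedra. *)
Fixpoint complement_cover (R : realType) (n : nat)
    (ss : seq (seq ('rV[R]_n * R))) : seq (seq ('rV[R]_n * R)) :=
  if ss is s :: ss' then
    [seq reverse_constraint h :: t | h <- s, t <- complement_cover ss']
  else [:: [::]].

Lemma dotvNl (R : realType) (n : nat) (x y : 'rV[R]_n) :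
  dotv (- x) y = - dotv x y.
Proof. by rewrite /dotv -sumrN; apply: eq_bigr => i _; rewrite mxE mulNr. Qed.

Lemma complement_coverP (R : realType) (n : nat)
    (ss : seq (seq ('rV[R]_n * R))) (x : 'rV[R]_n) :
  (exists2 s, s \in ss & polyhedron_of s x) \/
  (exists2 t, t \in complement_cover ss & polyhedron_of t x).
Proof.
elim: ss => [|s ss [[s' s'ss xs']|[t tss xt]]].
- by right; exists [::]; rewrite ?mem_seq1.
- by left; exists s' => //; rewrite in_cons s'ss orbT.
have [xs|] := pselect (polyhedron_of s x).
  by left; exists s => //; exact: mem_head.
move=> /existsNP[h /not_implyP[hs /negP]]; rewrite -ltNge => hx; right.
exists (reverse_constraint h :: t); first exact: (allpairs_f _ hs tss).
move=> h'; rewrite in_cons => /predU1P[->|]; last exact: xt.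
by rewrite /= dotvNl lerN2 ltW.
Qed.

Lemma complement_cover_proper (R : realType) (n : nat)
    (ss : seq (seq ('rV[R]_n * R))) t :
  (forall s, s \in ss -> proper_constraints s) ->
  t \in complement_cover ss -> proper_constraints t.
Proof.
elim: ss t => [|s ss IH] t ssp /=; first by rewrite mem_seq1 => /eqP->.
move=> /allpairsP[[h t'] /= [hs t'ss ->]] h'; rewrite in_cons => /predU1P[->|].
  by rewrite oppr_eq0; exact: (ssp s (mem_head _ _)).
by apply: (IH _ _ t'ss) => s' s'ss; apply: ssp; rewrite in_cons s'ss orbT.
Qed.

(** A point of the piece satisfies the reversal of some constraint of s, which
    holds strictly in the interior. *)
Lemma complement_cover_disjoint (R : realType) (n : nat)
    (ss : seq (seq ('rV[R]_n * R))) s t :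
  (forall s, s \in ss -> proper_constraints s) ->
  s \in ss -> t \in complement_cover ss -> polyhedron_of t `&` (polyhedron_of s)° = set0.
Proof.
move=> ssp sss tss; apply/seteqP; split=> // x [xt xs].
have {}xs h : h \in s -> dotv h.1 x < h.2.
  by apply: interior_polyhedron_of => //; exact: ssp.
elim: ss {ssp} sss t tss xt => //= s' ss IH.
rewrite in_cons => /predU1P[<-|sss] t /allpairsP[[h t'] /= [hs t'ss ->]] xt.
  have := xt _ (mem_head _ _); rewrite /= dotvNl lerN2 leNgt.
  by rewrite xs.
by apply: (IH sss t' t'ss) => h' h't'; apply: xt; rewrite in_cons h't' orbT.
Qed.

Lemma affset_nbhs (R : realType) (n : nat) (z y : 'rV[R]_n) (l : R)
    (Y : set 'rV[R]_n) : 0 < l -> Y° y -> (affset z l Y)° (z + l *: y).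
Proof.
move=> l0 /nbhs_ballP[e /= e0 eY]; apply/nbhs_ballP; exists (l * e) => /=.
  exact: mulr_gt0.
move=> w; rewrite -ball_normE /= => we.
have wE : w = z + l *: (l^-1 *: (w - z)).
  by rewrite scalerA divff ?gt_eqF// scale1r subrKC.
exists (l^-1 *: (w - z)); last by rewrite -wE.
apply: eY; rewrite -ball_normE /= -(ltr_pM2l l0).
move: we; rewrite {1}wE opprD addrACA subrr add0r -scalerBr normrZ.
by rewrite gtr0_norm.
Qed.

(** A strongly convex set other than the whole space is an intersection of a
    nonempty family of balls, hence lies in one of them. *)
Lemma strongly_convex_bounded (R : realType) (n : nat) (A : set 'rV[R]_n) :
  strongly_convex A -> A <> setT ->
  exists2 d, 0 < d & forall x y, A x -> A y -> `|x - y| <= d.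
Proof.
move=> [r r0 [D ->]] DT; have [c Dc] : exists c, D c.
  apply/not_existsP => D0; apply: DT; apply/seteqP; split=> // x _ c Dc.
  by have := D0 c.
exists (2 * r); first exact: mulr_gt0.
move=> x y /(_ c Dc)/eball_norm xc /(_ c Dc)/eball_norm yc.
rewrite (le_trans (ler_distD c _ _))// mulr_natl mulr2n lerD// distrC//.
Qed.

(** * The covering *)

Unset Implicit Arguments.

Theorem mainTheorem4 (R : realType) (n : nat) (n_ge2 : (2 <= n)%N)
    (X : set 'rV[R]_n) (X_open : open X)
    (U : finType) (G : 'rV[R]_n -> U -> 'rV[R]_n)
    (G_maps : forall x w, X x -> X (G x w))
    (G_diffeo : forall w : U, C1_diffeo_on X (fun x => G x w))
    (G_C11 : forall w : U, C11_on X (fun x => G x w))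
    (N : nat)
    (K : set 'rV[R]_n) (K_compact : compact K) (K_sub_X : K `<=` X)
    (V : set 'rV[R]_n) (V_open : open V) (V_sub_X : V `<=` X)
    (K_sub_V : K `<=` V)
    (Y : set 'rV[R]_n) (Y_poly : convex_polyhedron Y) (Y_fulldim : Y° !=set0)
    (Yhat : set 'rV[R]_n) (Yhat_sc : strongly_convex Yhat)
    (Y_sub_Yhat : Y `<=` Yhat) (Yhat_neqT : Yhat <> setT) :
  exists (Z : set 'rV[R]_n) (lambda : R) (C : set (set 'rV[R]_n)),
    let C' : set (set 'rV[R]_n) := [set affset z lambda Y | z in Z] in
    [/\ finite_set Z, 0 < lambda & C' `<=` C] /\
    (* (i) *)
    [/\ finite_set C,
        \bigcup_(D in C) D = setT,
        forall D, C D -> D !=set0 /\ convex_polyhedron D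
      & forall D, C' D ->
          exists Dhat : set 'rV[R]_n,
            [/\ D `<=` Dhat,
                Dhat `<=` X
              & forall (k : nat) (u : 'I_k -> U), (1 <= k <= N)%N ->
                  @convex_set R 'rV[R]_n (attainable G Dhat u)]] /\
    (* (ii) *)
    [/\ K `<=` sumset Z lambda Y,
        sumset Z lambda Y `<=` sumset Z lambda Yhat
      & sumset Z lambda Yhat `<=` V] /\
    (* additional requirements *)
    (forall D D', C D -> ~ C' D -> C' D' -> D `&` D'° = set0) /\
    (forall D, C D -> ~ C' D -> D `&` K = set0).
Proof.
have [y0 y0Y] := Y_fulldim.
have Yy0 : Y y0 := interior_subset y0Y.
have [d d0 Yhatd] := strongly_convex_bounded Yhat_sc Yhat_neqT.
have /convex_polyhedronP[sY sY0 YE] := Y_poly.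
have n0 : 0 < (n%:R : R) by rewrite ltr0n (leq_trans _ n_ge2).
have near_V : \forall e \near (0 : R)^'+, K `<=` [set x | eball x e `<=` V].
  move: (K_compact) => /compact_near_coveringP cK.
  apply: cK => x Kx; apply: near_eball; apply: open_nbhs_nbhs.
  by split=> //; exact: K_sub_V.
have [e [[eN eV] e0]] : exists e : R, ((forall x, K x ->
    forall (k : nat) (u : 'I_k -> U), (k <= N)%N ->
      @convex_set R 'rV[R]_n (attainable G (eball x e) u)) /\
    K `<=` [set x | eball x e `<=` V]) /\ 0 < e.
  apply: (@filter_ex _ (0 : R)^'+).
  apply: filterI (nbhs_right_gt _); apply: filterI near_V.
  exact: (near_convex_attainable _ X_open).
(* With this scale, Yhat moved by x - l y0 lies within l d of x in the sup norm,
   hence in the Euclidean ball of radius n (l d) = e. *)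
pose l := e / (n%:R * d).
have l0 : 0 < l by rewrite divr_gt0// mulr_gt0.
have ball_of x y : Yhat y -> eball x e (x - l *: y0 + l *: y).
  move=> Yy; have -> : e = n%:R * (l * d).
    by rewrite mulrCA divfK// gt_eqF// mulr_gt0.
  apply: norm_eball.
  rewrite addrAC [X in X + _]addrAC subrr add0r addrC -scalerBr normrZ gtr0_norm// (ler_wpM2l (ltW l0))//.
  by apply: Yhatd => //; exact: Y_sub_Yhat.
pose cell x := affset (x - l *: y0) l Y.
have cellint x : (cell x)° x.
  by rewrite -{2}[x](subrK (l *: y0)); exact: affset_nbhs.
have [D DK KD] : finite_subset_cover K (fun x => (cell x)°) K.
  move: K_compact; rewrite compact_cover; apply => [x _|x Kx].
    exact: open_interior.
  by exists x.
pose zs := [seq x - l *: y0 | x <- finmap.enum_fset D].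
have zsP z : z \in zs -> exists2 x, K x & z = x - l *: y0.
  by move=> /mapP[x /DK]; rewrite inE => Kx ->; exists x.
pose constr z := [seq (h.1, dotv h.1 z + l * h.2) | h <- sY].
have cellE z : affset z l Y = polyhedron_of (constr z) by rewrite YE affset_polyhedron_of.
have constr_proper z : proper_constraints (constr z).
  by move=> _ /mapP[h /sY0 h0 ->].
pose ss := map constr zs.
have ssp s : s \in ss -> proper_constraints s.
  by move=> /mapP[z _ ->]; exact: constr_proper.
pose C' := [set affset z l Y | z in [set` zs]].
pose C2 := [set polyhedron_of t | t in [set` complement_cover ss]].
exists [set` zs], l, (C' `|` [set D | C2 D /\ D !=set0]).
have outer E : (C' `|` [set D | C2 D /\ D !=set0]) E -> ~ C' E -> C2 E.
  by case=> [//|[]].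
have disj E E' : C2 E -> C' E' -> E `&` E'° = set0.
  move=> [t tss <-] [z zzs <-]; rewrite cellE.
  by apply: complement_cover_disjoint tss => //; exact: map_f.
have Kint x : K x -> exists2 E, C' E & E° x.
  move=> /KD[x' x'D xx']; exists (cell x') => //.
  by exists (x' - l *: y0) => //; exact: (map_f (fun x => x - l *: y0)).
split; last split; last split; last split.
- by split=> //; exact: finite_seq.
- split.
  + rewrite finite_setU; split; first exact/finite_image/finite_seq.
    apply: (@sub_finite_set _ _ C2); first by move=> E [].
    exact/finite_image/finite_seq.
  + apply/seteqP; split=> // x _.
    have [[s /mapP[z zzs ->] xs]|[t tss xt]] := complement_coverP ss x.
      by exists (affset z l Y); [left; exists z|rewrite cellE].
    exists (polyhedron_of t) => //; right; split; last by exists x.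
    by exists t.
  + move=> E [[z _ <-]|[[t tss <-] E0]].
      split; first by exists (z + l *: y0); exists y0.
      by apply/convex_polyhedronP; exists (constr z).
    split=> //; apply/convex_polyhedronP; exists t => //.
    exact: complement_cover_proper tss.
  + move=> _ [z /zsP[x Kx ->] <-]; exists (eball x e); split.
    * by move=> _ [y /Y_sub_Yhat Yy <-]; exact: ball_of.
    * by apply: subset_trans V_sub_X; exact: eV.
    * by move=> k u /andP[_ kN]; exact: eN.
- split.
  + move=> x /Kint[_ [z zzs <-] /interior_subset[y Yy <-]].
    by exists z => //; exists y.
  + by move=> _ [z zzs [y /Y_sub_Yhat Yy <-]]; exists z => //; exists y.
  + by move=> _ [z /zsP[x Kx ->] [y Yy <-]]; apply: (eV _ Kx); exact: ball_of.
- by move=> E E' EC nE E'C'; apply: disj => //; exact: outer.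
- move=> E EC nE; apply/seteqP; split=> // x [Ex /Kint[E' E'C' xE']].
  by rewrite -(disj _ _ (outer _ EC nE) E'C').
Qed.
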